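(* Let $T$ be a tree with $t\geq 3$ vertices and radius $h$, and let $G$ be a graph that does not contain $T$ as a minor. Then there exists a graph $H$ with $\mathrm{pw}(H)\leq 2h-1$ such that $G$ is contained in $H\boxtimes K_{t-2}$.
   Context: All graphs are simple, finite and undirected. $\mathrm{pw}$ denotes pathwidth, $K_c$ is the complete graph on $c$ vertices, and $\boxtimes$ is the strong product: $V(G\boxtimes H)=V(G)\times V(H)$, and distinct $(v,w),(v',w')$ are adjacent iff ($v=v'$ or $vv'\in E(G)$) and ($w=w'$ or $ww'\in E(H)$). ''$G$ is contained in $J$'' means $G$ is isomorphic to a subgraph of $J$. *)

(* Defs.v *)
From HB Require Import structures.
From mathcomp Require Import all_boot.
From mathcomp Require Import boolp.

Set Implicit Arguments.
Unset Strict Implicit.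
Unset Printing Implicit Defensive.

Record sgraph := SGraph {
  svertex :> finType;
  sedge : rel svertex;
  sedge_sym : symmetric sedge;
  sedge_irrefl : irreflexive sedge
}.

Definition connected (G : sgraph) : Prop :=
  0 < #|G| /\ forall x y : G, connect (@sedge G) x y.

(* A simple graph has no cycle of length 1, and a [ucycle] of length 2 is an
   edge traversed back and forth. *)
Definition acyclic (G : sgraph) : Prop :=
  forall c : seq G, ucycle (@sedge G) c -> size c < 3.

Definition is_tree (G : sgraph) : Prop := connected G /\ acyclic G.

(* Shortest paths have fewer than #|G| edges; the default value #|G| is only
   reached by pairs of vertices in different components. *)
Definition dist (G : sgraph) (x y : G) : nat :=
  \big[minn/#|G|]_(n < #|G| |
     [exists p : n.-tuple G, path (@sedge G) x p && (last x p == y)]) n.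

Definition eccentricity (G : sgraph) (x : G) : nat := \max_(y : G) dist x y.

(* On a connected graph every eccentricity is less than the default #|G|. *)
Definition radius (G : sgraph) : nat :=
  \big[minn/#|G|]_(x : G) eccentricity x.

Definition isomorphic (G J : sgraph) : Prop :=
  exists f : G -> J,
    bijective f /\ forall x y : G, sedge (f x) (f y) = sedge x y.

Record subgraph (J : sgraph) := Subgraph {
  sub_verts : {set J};
  sub_edges : rel J;
  sub_edges_sym : symmetric sub_edges;
  sub_edgesP : forall x y : J, sub_edges x y ->
    [/\ x \in sub_verts, y \in sub_verts & sedge x y]
}.

Section SubgraphGraph.
Variables (J : sgraph) (S : subgraph J).

Definition subgraph_rel : rel {x : J | x \in sub_verts S} :=
  fun u v => sub_edges S (val u) (val v).

Lemma subgraph_rel_sym : symmetric subgraph_rel.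
Proof. by move=> u v; apply: sub_edges_sym. Qed.

Lemma subgraph_rel_irrefl : irreflexive subgraph_rel.
Proof.
by move=> u; apply/negP => /sub_edgesP[_ _]; rewrite sedge_irrefl.
Qed.

Definition graph_of_subgraph : sgraph :=
  SGraph subgraph_rel_sym subgraph_rel_irrefl.
End SubgraphGraph.

Definition contained (G J : sgraph) : Prop :=
  exists S : subgraph J, isomorphic G (graph_of_subgraph S).

(* [A] is nonempty and induces a connected subgraph of [G]. *)
Definition connected_set (G : sgraph) (A : {set G}) : Prop :=
  A != set0 /\
  {in A &, forall x y,
     connect [rel u v | [&& u \in A, v \in A & sedge u v]] x y}.

(* [T] is a minor of [G], given by the branch sets of a model of [T] in [G]. *)
Definition minor (T G : sgraph) : Prop :=
  exists B : T -> {set G},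
    [/\ forall a : T, connected_set (B a),
        forall a b : T, a != b -> [disjoint B a & B b]
      & forall a b : T, sedge a b ->
          exists x y : G, [/\ x \in B a, y \in B b & sedge x y]].

Definition path_decomposition (G : sgraph) (s : seq {set G}) : Prop :=
  [/\ forall x : G, exists2 B, B \in s & x \in B,
      forall x y : G, sedge x y -> exists2 B, B \in s & (x \in B) && (y \in B)
    & forall (x : G) (i j k : nat), i <= j <= k -> k < size s ->
        x \in nth set0 s i -> x \in nth set0 s k -> x \in nth set0 s j].

(* With truncated predecessor, the width is 0 instead of -1 when all bags are
   empty, which only happens for the graph without vertices. *)
Definition width (G : sgraph) (s : seq {set G}) : nat :=
  (\max_(B <- s) #|B|).-1.

Lemma path_decomposition_setT (G : sgraph) :
  path_decomposition [:: [set: G]].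
Proof.
split=> [x|x y _|x i j k /andP[_ jk]].
- by exists setT; rewrite ?inE.
- by exists setT; rewrite ?inE.
- by rewrite ltnS leqn0 => /eqP k0; move: jk; rewrite k0 leqn0 => /eqP ->.
Qed.

Lemma ex_width (G : sgraph) :
  exists k, `[< exists2 s : seq {set G}, path_decomposition s & width s = k >].
Proof.
exists (width [:: [set: G]]); apply/asboolP.
by exists [:: [set: G]] => //; apply: path_decomposition_setT.
Qed.

Definition pathwidth (G : sgraph) : nat := ex_minn (ex_width G).

Section Complete.
Variable c : nat.

Definition complete_rel : rel 'I_c := fun i j => i != j.

Lemma complete_rel_sym : symmetric complete_rel.
Proof. by move=> i j; rewrite /complete_rel eq_sym. Qed.

Lemma complete_rel_irrefl : irreflexive complete_rel.
Proof. by move=> i; rewrite /complete_rel eqxx. Qed.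

Definition complete_graph : sgraph :=
  SGraph complete_rel_sym complete_rel_irrefl.
End Complete.

Section StrongProduct.
Variables G H : sgraph.

Definition strong_product_rel : rel (G * H) := fun p q =>
  [&& p != q,
      (p.1 == q.1) || sedge p.1 q.1
    & (p.2 == q.2) || sedge p.2 q.2].

Lemma strong_product_rel_sym : symmetric strong_product_rel.
Proof.
move=> p q; rewrite /strong_product_rel (eq_sym p) (eq_sym p.1) (eq_sym p.2).
by rewrite (sedge_sym p.1) (sedge_sym p.2).
Qed.

Lemma strong_product_rel_irrefl : irreflexive strong_product_rel.
Proof. by move=> p; rewrite /strong_product_rel eqxx. Qed.

Definition strong_product : sgraph :=
  SGraph strong_product_rel_sym strong_product_rel_irrefl.
End StrongProduct.

(* Main.v *)
Require Import Defs.
From HB Require Import structures.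
From mathcomp Require Import all_boot order.
From mathcomp Require Import boolp zify.

Set Implicit Arguments.
Unset Strict Implicit.
Unset Printing Implicit Defensive.

Import Order.TTheory.

(* Root [T] at a center.  By induction on [h], a connected set [C] either has a partition
   into parts of at most [t - 2] vertices whose quotient has a path decomposition with
   [2 * h] parts per bag, or contains, for every [a] in [C], a model of every rooted tree
   of height at most [h] with at most [t] vertices whose root branch set contains [a].

   For the induction step, sweep [C] by a growing connected set [P] starting from [[set a]].
   If the part [Y] of [C] outside [P] contained disjoint models of the subtrees below the
   children of the root, all rooted at neighbours of [P], then [P] would serve as root
   branch set.  Otherwise [Y] contains a set [S] of at most [t - 2] vertices and a set [Z]
   that decomposes with [2 * (h - 1)] parts per bag, such that all neighbours of [Z] or [P]
   in [Y] lie in [Z] or [S].  Take [S] as the next part: the bags for [Z], with [S] and the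
   previous such part added, have [2 * h] parts.

   To find [Z] and [S], the subtrees are embedded one after the other as in the proof of
   Bienstock, Robertson, Seymour and Thomas: a partial model is kept with one vertex of [S]
   in each branch set, for a separation [(Z, S)] that is maximal with [#|S|] equal to the
   number of branch sets and [Z] decomposable, and Menger's theorem moves the branch sets
   forward when [(Z, S)] grows.  When the embedding is stuck at [s] in [S], maximality says
   that [s |: Z] is not decomposable, so the induction hypothesis provides the whole subtree
   at once. *)

(** * Connected sets *)

Lemma setI_neq0P (T : finType) (A B : {set T}) :
  reflect (exists2 x, x \in A & x \in B) (A :&: B != set0).
Proof.
by apply: (iffP (set0Pn _)) => [[x /setIP[]]|[x xA xB]]; exists x; rewrite ?inE ?xA.
Qed.

Lemma disjoint_setUl (T : finType) (A B C : {set T}) :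
  [disjoint A :|: B & C] = [disjoint A & C] && [disjoint B & C].
Proof. by rewrite -!setI_eq0 setIUl setU_eq0. Qed.

Lemma disjoint_setUr (T : finType) (A B C : {set T}) :
  [disjoint A & B :|: C] = [disjoint A & B] && [disjoint A & C].
Proof. by rewrite disjoint_sym disjoint_setUl !(disjoint_sym _ (mem A)). Qed.

Lemma disjoint_setDr (T : finType) (A B : {set T}) : [disjoint A & B :\: A].
Proof. by rewrite disjoint_sym disjoints_subset setDE subsetIr. Qed.

(* Without [clear], [lia] would split cases on every boolean hypothesis. *)
Ltac decide_membership := rewrite ?inE; clear; lia.

Section ConnectedSets.
Variable G : sgraph.
Implicit Types (A B C D E R S U : {set G}) (x y : G).

Definition nbhd A : {set G} := \bigcup_(x in A) [set y | sedge x y].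

Lemma nbhdP A y : reflect (exists2 x, x \in A & sedge x y) (y \in nbhd A).
Proof. by apply: (iffP bigcupP) => -[x xA]; rewrite ?inE => xy; exists x; rewrite ?inE. Qed.

Lemma nbhdU A B : nbhd (A :|: B) = nbhd A :|: nbhd B.
Proof. exact: bigcup_setU. Qed.

Lemma nbhdS A B : A \subset B -> nbhd A \subset nbhd B.
Proof. by move=> /setUidPr <-; rewrite nbhdU subsetUl. Qed.

Lemma nbhd0 : nbhd set0 = set0.
Proof. exact: big_set0. Qed.

Definition adjacent A B : bool := nbhd A :&: B != set0.

Lemma adjacentP A B :
  reflect (exists x y, [/\ x \in A, y \in B & sedge x y]) (adjacent A B).
Proof.
apply: (iffP (setI_neq0P _ _)) => [[y /nbhdP[x xA xy] yB]|[x [y [xA yB xy]]]].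
  by exists x, y.
by exists y => //; apply/nbhdP; exists x.
Qed.

Lemma adjacent_sym A B : adjacent A B = adjacent B A.
Proof. by apply/adjacentP/adjacentP=> -[x [y [xA yB xy]]]; exists y, x; rewrite sedge_sym. Qed.

Lemma adjacentS A A' B B' : A \subset A' -> B \subset B' -> adjacent A B -> adjacent A' B'.
Proof.
move=> /subsetP AA' /subsetP BB' /adjacentP[x [y [xA yB xy]]].
by apply/adjacentP; exists x, y; split; rewrite ?AA' ?BB'.
Qed.

Definition component U x : {set G} :=
  [set y | connect [rel u v | [&& u \in U, v \in U & sedge u v]] x y].

Lemma mem_component U x : x \in component U x.
Proof. by rewrite inE. Qed.

Lemma component_min U R x : x \in R -> nbhd R :&: U \subset R -> component U x \subset R.
Proof.
move=> xR /subsetP closedR; apply/subsetP=> y; rewrite inE => /connectP[q qP ->].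
elim: q x xR qP => //= z q IH x xR /andP[/and3P[_ zU xz] qP]; apply: IH qP.
by apply: closedR; rewrite inE zU andbT; apply/nbhdP; exists x.
Qed.

Lemma component_sub U x : x \in U -> component U x \subset U.
Proof. by move=> xU; apply: component_min => //; apply: subsetIr. Qed.

Lemma component_closed U x : x \in U -> nbhd (component U x) :&: U \subset component U x.
Proof.
move=> xU; apply/subsetP=> v /setIP[/nbhdP[u uC uv] vU].
have uU := subsetP (component_sub xU) u uC; move: uC; rewrite !inE => xu.
by apply: connect_trans xu _; apply: connect1; rewrite /= uU vU.
Qed.

Lemma connected_set_component A x : connected_set A -> x \in A -> A \subset component A x.
Proof. by move=> [_ conA] xA; apply/subsetP=> y yA; rewrite inE conA. Qed.

Lemma connected_setP A x : x \in A ->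
  connected_set A <-> forall R, x \in R -> nbhd R :&: A \subset R -> A \subset R.
Proof.
move=> xA; split=> [conA R xR closedR | closedA].
  exact: subset_trans (connected_set_component conA xA) (component_min xR closedR).
have /subsetP reach := closedA _ (mem_component A x) (component_closed xA).
split=> [|y z /reach + /reach]; first by apply/set0Pn; exists x.
rewrite !inE => xy; apply: connect_trans.
rewrite sym_connect_sym // => u v /=; rewrite sedge_sym; decide_membership.
Qed.

Lemma connected_set_sub A R x :
  connected_set A -> x \in A -> x \in R -> nbhd R :&: A \subset R -> A \subset R.
Proof. by move=> conA xA; apply: (proj1 (connected_setP xA)). Qed.

Lemma connected_set1 x : connected_set [set x].
Proof. by apply/(connected_setP (set11 x)) => R xR _; rewrite sub1set. Qed.

Lemma component_connected U x : x \in U -> connected_set (component U x).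
Proof.
move=> xU; apply/(connected_setP (mem_component U x)) => R xR closedR.
suff : component U x \subset R :&: component U x by rewrite subsetI => /andP[].
apply: component_min; first by rewrite in_setI xR mem_component.
apply/subsetP=> v /setIP[vN vU]; have vC : v \in component U x.
  apply: (subsetP (component_closed xU)); rewrite in_setI vU andbT.
  exact: subsetP (nbhdS (subsetIr _ _)) _ vN.
rewrite in_setI vC andbT; apply: (subsetP closedR); rewrite in_setI vC andbT.
exact: subsetP (nbhdS (subsetIl _ _)) _ vN.
Qed.

Lemma connected_setU_adjacent A B :
  connected_set A -> connected_set B -> adjacent A B -> connected_set (A :|: B).
Proof.
move=> conA conB /adjacentP[x [y [xA yB xy]]].
have xAB : x \in A :|: B by rewrite inE xA.
apply/(connected_setP xAB) => R xR; rewrite setIUr subUset => /andP[closedA closedB].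
rewrite subUset (connected_set_sub conA xA xR closedA).
apply: (connected_set_sub conB yB) (closedB).
by apply: (subsetP closedB); rewrite inE yB andbT; apply/nbhdP; exists x.
Qed.

Lemma connected_setU_bigcup A S (P : G -> {set G}) :
  connected_set A -> {in A :&: S, forall x, connected_set (P x) /\ x \in P x} ->
  connected_set (A :|: \bigcup_(x in A :&: S) P x).
Proof.
move=> conA conP; have [/set0Pn[x xA] _] := conA; set D := _ :|: _.
have xD : x \in D by rewrite inE xA.
apply/(connected_setP xD) => R xR closedR.
have closed_sub E : E \subset D -> nbhd R :&: E \subset R.
  by move=> ED; apply: subset_trans closedR; apply: setIS.
have /subsetP AR : A \subset R.
  by apply: connected_set_sub xA xR _ => //; apply: closed_sub; apply: subsetUl.
rewrite subUset; apply/andP; split; first exact/subsetP.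
apply/bigcupsP=> y yAS; have [conPy yPy] := conP y yAS; have /setIP[yA _] := yAS.
apply: connected_set_sub conPy yPy (AR y yA) (closed_sub _ _).
by apply: subset_trans (subsetUr _ _); apply: (bigcup_sup y).
Qed.

(* [D] is the component of [b] in [E] minus [C], plus one vertex of [C]. *)
Lemma connected_set_approach E C b :
  connected_set E -> b \in E -> E :&: C != set0 ->
  exists D a, [/\ connected_set D, D \subset E, b \in D & D :&: C = [set a]].
Proof.
move=> conE bE EC; have [bC|bC] := boolP (b \in C).
  exists [set b], b; split; rewrite ?set11 ?sub1set //; first exact: connected_set1.
  by apply/setIidPl; rewrite sub1set.
have bEC : b \in E :\: C by rewrite inE bC.
pose D := component (E :\: C) b; have bD : b \in D := mem_component _ b.
have /subsetDP[DE DC] : D \subset E :\: C := component_sub bEC.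
have closedD : nbhd D :&: (E :\: C) \subset D := component_closed bEC.
have [a /setIP[aN aE] aC] : exists2 a, a \in nbhd D :&: E & a \in C.
  apply/setI_neq0P; apply: contraNneq EC => NDC0.
  suff ED : E \subset D by rewrite -subset0 -(disjoint_setI0 DC) setSI.
  apply: connected_set_sub conE bE bD _.
  apply/subsetP=> v vNE; apply: (subsetP closedD).
  have : v \notin nbhd D :&: E :&: C by rewrite NDC0 inE.
  by move: vNE; rewrite !in_setI in_setD; decide_membership.
exists (D :|: [set a]), a; split.
- apply: connected_setU_adjacent (component_connected bEC) (connected_set1 a) _.
  by apply/setI_neq0P; exists a; rewrite ?set11.
- by rewrite subUset DE sub1set.
- by rewrite inE bD.
- by rewrite setIUl (disjoint_setI0 DC) set0U; apply/setIidPl; rewrite sub1set.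
Qed.

End ConnectedSets.

(** * Menger's theorem *)

Section Linkages.
Variable G : sgraph.
Implicit Types (A B D Q R S U : {set G}).

Definition packing (I : finType) (W : {set I}) U (beta : I -> {set G}) : Prop :=
  [/\ {in W, forall w, connected_set (beta w)},
      {in W, forall w, beta w \subset U}
    & forall w w' x, w \in W -> w' \in W -> x \in beta w -> x \in beta w' -> w = w'].

Definition linkage A U B (P : G -> {set G}) : Prop :=
  packing A U P /\ {in A, forall a, a \in P a /\ P a :&: B != set0}.

Definition prolong (I : finType) (beta : I -> {set G}) S (P : G -> {set G}) (w : I) :=
  beta w :|: \bigcup_(x in beta w :&: S) P x.

Lemma packing_sub (I : finType) (W : {set I}) U U' beta :
  U \subset U' -> packing W U beta -> packing W U' beta.
Proof.
by move=> UU' [con sub inj]; split=> // w wW; apply: subset_trans (sub w wW) UU'.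
Qed.

Lemma packing_add (I : finType) (W : {set I}) U beta w D :
  connected_set D -> [disjoint D & U] -> packing W U beta ->
  packing (w |: W) (D :|: U) [eta beta with w |-> D].
Proof.
move=> conD DU [con sub inj]; have subU v x : v \in W -> x \in beta v -> x \in U.
  by move=> vW; apply: subsetP (sub v vW) x.
split=> [v|v|v v' x] /=.
- by case: eqVneq => //= nvw; rewrite !inE (negPf nvw); apply: con.
- case: eqVneq => [_ _|nvw]; first exact: subsetUl.
  by rewrite !inE (negPf nvw) => /sub vU; apply: subset_trans vU (subsetUr _ _).
- rewrite !inE; case: (eqVneq v w) => [->|_]; case: (eqVneq v' w) => [->|_] //=.
  + by move=> _ /subU xU xD /xU; rewrite (disjointFr DU xD).
  + by move=> /subU xU _ /xU + xD; rewrite (disjointFr DU xD).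
  + exact: inj.
Qed.

Lemma packing_prolong (I : finType) (W : {set I}) U1 U2 S B beta P :
  U1 :&: U2 \subset S -> packing W U1 beta -> linkage S U2 B P ->
  packing W (U1 :|: U2) (prolong beta S P).
Proof.
move=> /subsetP U12 [con sub inj] [[conP subP injP] endsP].
have prolongP w y : y \in prolong beta S P w ->
    y \in beta w \/ exists x, [/\ x \in beta w, x \in S & y \in P x].
  by case/setUP=> [|/bigcupP[x /setIP[xw xS]]]; [left|right; exists x].
have meet w w' x y : w \in W -> w' \in W ->
    y \in beta w -> x \in beta w' -> x \in S -> y \in P x -> w = w'.
  move=> wW w'W yw xw' xS yx; apply: (inj w w' x) => //.
  have yS : y \in S.
    by apply: U12; rewrite inE (subsetP (sub w wW)) // (subsetP (subP x xS)).
  by rewrite -(injP y x y) //; case: (endsP y yS).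
split=> [w wW|w wW|w w' y wW w'W].
- apply: connected_setU_bigcup; first exact: con.
  by move=> x /setIP[_ xS]; split; [apply: conP | case: (endsP x xS)].
- rewrite subUset (subset_trans (sub w wW) (subsetUl _ _)).
  apply/bigcupsP=> x /setIP[_ xS].
  exact: subset_trans (subP x xS) (subsetUr _ _).
- case/prolongP=> [yw|[x [xw xS yx]]] /prolongP[yw'|[x' [xw' xS' yx']]].
  + exact: inj yw yw'.
  + exact: meet yw xw' xS' yx'.
  + by apply/esym; apply: meet yw' xw xS yx.
  + by apply: (inj w w' x) => //; rewrite (injP x x' y).
Qed.

Lemma prolong_meets (I : finType) (beta : I -> {set G}) S U B P w :
  linkage S U B P -> beta w :&: S != set0 -> prolong beta S P w :&: B != set0.
Proof.
move=> [_ endsP] /set0Pn[x xw]; have /setIP[_ /endsP[_ /setI_neq0P[y yx yB]]] := xw.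
by apply/setI_neq0P; exists y => //; apply/setUP; right; apply/bigcupP; exists x.
Qed.

Lemma linkage_prolong A U1 U2 Q B P1 P2 :
  U1 :&: U2 \subset Q -> linkage A U1 Q P1 -> linkage Q U2 B P2 ->
  linkage A (U1 :|: U2) B (prolong P1 Q P2).
Proof.
move=> U12 [packP1 endsP1] linkP2; split; first exact: packing_prolong packP1 linkP2.
move=> a /endsP1[aP aQ]; split; first by rewrite inE aP.
exact: prolong_meets linkP2 aQ.
Qed.

Lemma linkage_set1 A U B : A \subset U -> A \subset B -> linkage A U B (fun x => [set x]).
Proof.
move=> /subsetP AU /subsetP AB; split=> [|a aA].
  split=> [a _|a /AU aU|a a' x _ _ /set1P <- /set1P //]; rewrite ?sub1set //.
  exact: connected_set1.
by split; rewrite ?set11 //; apply/setI_neq0P; exists a; rewrite ?set11 ?AB.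
Qed.

(* The [A]-side [R] of an [A]-[B] separation has the frontier as its separator. *)
Definition frontier U A R : {set G} := (A :|: nbhd R) :&: U :\: R.

Definition linked A U B : Prop :=
  forall R, R \subset U :\: B -> #|A| <= #|frontier U A R|.

Lemma linked_leq_card A U B : linked A U B -> #|A| <= #|U :&: B|.
Proof.
move=> /(_ (U :\: B) (subxx _))/leq_trans; apply; apply: subset_leq_card.
by apply/subsetP=> x; decide_membership.
Qed.

Lemma linked_far_side A U B R : linked A U B -> R \subset U :\: B ->
  #|frontier U A R| = #|A| -> linked (frontier U A R) (U :\: R) B.
Proof.
move=> lkA RUB cardQ R' R'UB; rewrite cardQ; apply: leq_trans (lkA (R :|: R') _) _.
  rewrite subUset RUB; apply: subset_trans R'UB _; apply: setSD; exact: subsetDl.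
apply/subset_leq_card/subsetP=> y; rewrite inE nbhdU; decide_membership.
Qed.

Lemma linked_near_side A U B R : linked A U B -> A \subset U -> R \subset U :\: B ->
  linked A (R :|: frontier U A R) (frontier U A R).
Proof.
move=> lkA /subsetP AU RUB R' R'UB.
have R'R : R' \subset R.
  by apply/subsetP=> x xR'; have := subsetP R'UB x xR'; decide_membership.
apply: leq_trans (lkA R' (subset_trans R'R RUB)) _.
apply/subset_leq_card/subsetP=> y; have := subsetP (nbhdS R'R) y; have := AU y.
decide_membership.
Qed.

Lemma linkage_edge A a u : a \in A -> sedge a u -> u \notin A ->
  linkage A (u |: A) (u |: A :\ a) [eta fun x => [set x] with a |-> [set a; u]].
Proof.
move=> aA au uA; have uAa : u \notin A :\ a by rewrite in_setD1 (negPf uA) andbF.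
have [packA _] := linkage_set1 (subxx (A :\ a)) (subxx (A :\ a)).
split=> [|x xA] /=; last first.
  have [->|xa] := eqVneq x a; split; rewrite ?inE ?eqxx //; apply/setI_neq0P.
    by exists u; rewrite !inE eqxx ?orbT.
  by exists x; rewrite !inE ?eqxx // xa xA orbT.
rewrite -[X in packing X](setD1K aA) -[X in packing _ (u |: X)](setD1K aA) setUCA setUA.
apply: packing_add packA.
  apply: connected_setU_adjacent; try exact: connected_set1.
  by apply/adjacentP; exists a, u; rewrite !set11.
by rewrite disjoints_subset subUset !sub1set in_setC setD11 in_setC uAa.
Qed.

Lemma linked_neighbour A U B a : linked A U B -> a \in A -> a \in U :\: B ->
  exists2 u, sedge a u & u \in U :\: A.
Proof.
move=> lkA aA aUB; apply: contrapT => no_nbr.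
suff : #|A| <= #|A :\ a| by rewrite (cardsD1 a A) aA ltnn.
apply: leq_trans (lkA [set a] _) _; first by rewrite sub1set.
apply/subset_leq_card/subsetP=> u /setDP[/setIP[/setUP[uA|au] uU] ua].
  by rewrite in_setD ua.
apply: contrapT => uAa; apply: no_nbr; case/nbhdP: au => _ /set1P -> au.
by exists u => //; move: ua uAa; rewrite !inE uU => -> /negP ->.
Qed.

Lemma linkage_shift A U B a u P : A \subset U -> a \in A -> sedge a u -> u \in U :\: A ->
  linkage (u |: A :\ a) (U :\ a) B P -> exists P', linkage A U B P'.
Proof.
move=> AU aA au /setDP[uU uA] linkP.
have -> : U = (u |: A) :|: (U :\ a).
  apply/setP=> x; have := subsetP AU x; rewrite !inE.
  have [->|_] := eqVneq x u; first by rewrite uU.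
  by have [->|_] := eqVneq x a; rewrite ?(subsetP AU a aA) ?aA; decide_membership.
eexists; apply: linkage_prolong (linkage_edge aA au uA) linkP.
by apply/subsetP=> x; decide_membership.
Qed.

Lemma exists_tight_frontier A U B a u :
  A \subset U -> linked A U B -> a \in A -> a \notin B -> u \in U :\: A ->
  ~ linked (u |: A :\ a) (U :\ a) B ->
  exists R, [/\ R \subset U :\: B, R != set0, #|frontier U A R| = #|A|
               & ~~ (frontier U A R \subset B)].
Proof.
move=> AU lkA aA aB /setDP[uU uA] /existsNP[R /not_implyP[RUaB /negP]].
set A' := u |: A :\ a; rewrite -ltnNge => smallQ.
have cardA' : #|A'| = #|A|.
  by rewrite cardsU1 (cardsD1 a A) aA in_setD1 (negPf uA) andbF.
have RUB : R \subset U :\: B by apply: subset_trans RUaB (setSD _ (subsetDl _ _)).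
have aR : a \notin R by apply/negP=> /(subsetP RUaB); rewrite !inE eqxx andbF.
have aQ : a \in frontier U A R by rewrite !inE aR aA (subsetP AU a aA).
exists R; split=> //; last by apply/subsetPn; exists a.
  apply: contraTneq smallQ => R0; rewrite -leqNgt; apply/subset_leq_card.
  apply/subsetP=> x xA'; rewrite R0 /frontier setD0 in_setI in_setU xA' /= in_setD1.
  move: xA'; rewrite !inE => /orP[/eqP ->|/andP[-> /(subsetP AU) //]].
  by rewrite uU andbT; apply: contraNneq uA => ->.
apply/eqP; rewrite eqn_leq lkA // andbT; move: smallQ; rewrite cardA'; apply: leq_trans.
rewrite (cardsD1 a) aQ ltnS; apply/subset_leq_card/subsetP=> x.
by rewrite !inE; case: (eqVneq x a) => //=; decide_membership.
Qed.

Lemma near_side_proper A U B R :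
  linked A U B -> R \subset U :\: B -> #|frontier U A R| = #|A| ->
  ~~ (frontier U A R \subset B) -> R :|: frontier U A R \proper U.
Proof.
move=> lkA RUB cardQ QB; set Q := frontier U A R in cardQ QB *.
rewrite properEneq andbC subUset (subset_trans RUB (subsetDl _ _)) /=; apply/andP; split.
  by rewrite /Q /frontier; apply/subsetP=> x; decide_membership.
apply: contraNneq QB => UE; have UBQ : U :&: B \subset Q.
  apply/subsetP=> x /setIP[]; rewrite -{1}UE => /setUP[|//].
  by case/(subsetP RUB)/setDP => _ /negP.
suff /eqP <- : U :&: B == Q by apply: subsetIr.
by rewrite eqEcard UBQ cardQ linked_leq_card.
Qed.

(* Move a vertex [a] of [A] along an edge to [u].  If this destroys linkedness, the
   obstruction together with [a] is a minimum separator, which splits [U] into two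
   smaller parts. *)
Theorem menger A U B : A \subset U -> linked A U B -> exists P, linkage A U B P.
Proof.
have [n] := ubnP #|U|; elim: n => // n IH in A U B *; rewrite ltnS => Un AU lkA.
have smaller U' : U' \proper U -> #|U'| < n.
  by move=> U'U; apply: leq_trans (proper_card U'U) Un.
have [AB|/subsetPn[a aA aB]] := boolP (A \subset B).
  by exists (fun x => [set x]); apply: linkage_set1.
have aU := subsetP AU a aA.
have [|u au uUA] := linked_neighbour lkA aA; first by rewrite inE aB.
have [lkA'|] := pselect (linked (u |: A :\ a) (U :\ a) B).
  have [|P] := IH _ _ B (smaller _ (properD1 aU)) _ lkA'; last exact: linkage_shift.
  case/setDP: uUA => uU uA; rewrite subUset sub1set !inE uU andbT setSD // andbT.
  by apply: contraNneq uA => ->.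
case/(exists_tight_frontier AU lkA aA aB uUA) => R [RUB R0 cardQ QB].
have [RU QU] : R \subset U /\ frontier U A R \subset U.
  by split; apply/subsetP=> x; first have := subsetP RUB x; decide_membership.
have [P1 linkP1] : exists P, linkage A (R :|: frontier U A R) (frontier U A R) P.
  apply: IH (linked_near_side lkA AU RUB).
    exact: smaller (near_side_proper lkA RUB cardQ QB).
  by apply/subsetP=> x xA; have := subsetP AU x xA; rewrite !inE xA; decide_membership.
have [P2 linkP2] : exists P, linkage (frontier U A R) (U :\: R) B P.
  apply: IH (linked_far_side lkA RUB cardQ).
    apply: smaller; rewrite properEneq subsetDl andbT; apply: contraNneq R0 => UR.
    by rewrite -subset0; apply/subsetP=> x xR; have := subsetP RU x xR; rewrite -UR inE xR.
  exact: setSD (subsetIr _ _).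
have -> : U = (R :|: frontier U A R) :|: (U :\: R).
  apply/setP=> x; move: (subsetP RU x) (subsetP QU x); decide_membership.
eexists; apply: linkage_prolong linkP1 linkP2.
by apply/subsetP=> x; decide_membership.
Qed.

End Linkages.

(** * Maximal separations *)

Section Separations.
Variable G : sgraph.
Implicit Types (C R S Y Z : {set G}) (y : G).

Definition separation Y Z S : Prop :=
  [/\ Z \subset Y, S \subset Y, [disjoint Z & S] & nbhd Z :&: Y \subset Z :|: S].

Lemma separation0 Y : separation Y set0 set0.
Proof. by split; rewrite ?sub0set ?nbhd0 ?set0I ?sub0set // -setI_eq0 set0I. Qed.

Lemma separationU Y Z S Z' S' :
  separation Y Z S -> separation (Y :\: (Z :|: S)) Z' S' ->
  separation Y (Z :|: Z') (S :|: S').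
Proof.
rewrite /separation !disjoints_subset.
move=> [ZY SY dZS sepZ] [Z'Y S'Y dZS' sepZ'].
split; apply/subsetP=> y; rewrite ?nbhdU.
- by move: (subsetP ZY y) (subsetP Z'Y y); decide_membership.
- by move: (subsetP SY y) (subsetP S'Y y); decide_membership.
- move: (subsetP dZS y) (subsetP dZS' y) (subsetP Z'Y y) (subsetP S'Y y).
  by decide_membership.
- by move: (subsetP sepZ y) (subsetP sepZ' y); decide_membership.
Qed.

Variable good : {set G} -> Prop.

Definition dominates Z' S' Z S : Prop :=
  [/\ Z \subset Z', Z :|: S \subset Z' :|: S' & #|S'| <= #|S|].

Definition maximal_separation Y Z S : Prop :=
  [/\ separation Y Z S, good Z
    & forall Z' S', separation Y Z' S' -> good Z' -> dominates Z' S' Z S -> Z' = Z].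

Lemma exists_maximal_separation Y Z S : separation Y Z S -> good Z ->
  exists Z' S', maximal_separation Y Z' S' /\ dominates Z' S' Z S.
Proof.
move=> sepZ goodZ.
pose P := [pred q : {set G} * {set G} |
  `[< [/\ separation Y q.1 q.2, good q.1 & dominates q.1 q.2 Z S] >]].
have PZS : P (Z, S) by apply/asboolP.
have [[Z' S'] /asboolP[/= sepZ' goodZ' domZ'] maxZ'] :=
  arg_maxnP (fun q : {set G} * {set G} => #|q.1|) PZS.
exists Z', S'; split=> //; split=> // Z2 S2 sepZ2 goodZ2 [ZZ2 ZS2 S2S'].
apply/esym/eqP; rewrite eqEcard ZZ2; apply: (maxZ' (Z2, S2)); apply/asboolP; split=> //.
have [ZZ' ZS' S'S] := domZ'.
by split; [apply: subset_trans ZZ2|apply: subset_trans ZS2|apply: leq_trans S'S].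
Qed.

Definition hereditary_additive : Prop :=
  [/\ good set0, forall Z Z', Z' \subset Z -> good Z -> good Z'
    & forall Z Z', ~~ adjacent Z Z' -> good Z -> good Z' -> good (Z :|: Z')].

Hypothesis good_closed : hereditary_additive.

(* A separator smaller than [y |: S] would, together with the part of [Z'] that it
   cuts off, contradict the maximality of [(Z, S)]. *)
Lemma maximal_separation_linked Y Z S y Z' S' :
  maximal_separation Y Z S -> y \notin Z :|: S -> separation Y Z' S' -> good Z' ->
  dominates Z' S' Z (y |: S) -> linked (y |: S) ((Z' :|: S') :\: Z) S'.
Proof.
move=> [[ZY SY dZS sepZ] goodZ maxZ] yZS [Z'Y S'Y _ sepZ'] goodZ' [ZZ' ZS1 _] R RU.
have /norP[yZ yS] : ~~ ((y \in Z) || (y \in S)) by rewrite -in_setU.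
set U := (Z' :|: S') :\: Z in RU *; set Q := frontier U (y |: S) R.
rewrite leqNgt cardsU1 yS ltnS; apply/negP=> QS.
have RZ' : R \subset Z'.
  by apply/subsetP=> x /(subsetP RU); decide_membership.
have QY : Q \subset Y.
  apply/subsetP=> x; move: (subsetP Z'Y x) (subsetP S'Y x); decide_membership.
have /setUidPl RZ : Z :|: R = Z.
  apply: (maxZ _ Q) => //.
  - split=> //; first by rewrite subUset ZY (subset_trans RZ').
    + rewrite disjoints_subset; apply/subsetP=> x; decide_membership.
    + apply/subsetP=> x; move: (subsetP (nbhdS RZ') x) (subsetP sepZ x) (subsetP sepZ' x).
      move: (subsetP ZS1 x); rewrite nbhdU; decide_membership.
  - by have [_ good_sub _] := good_closed; apply: good_sub goodZ'; rewrite subUset ZZ'.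
  - split=> //; first exact: subsetUl.
    apply/subsetP=> x; move: (subsetP ZS1 x); decide_membership.
have R0 : R = set0.
  apply/eqP; rewrite -subset0; apply/subsetP=> x xR; have := subsetP RU x xR.
  by rewrite !inE (subsetP RZ x xR) andbF.
suff /subset_leq_card : y |: S \subset Q by rewrite cardsU1 yS ltnNge QS.
have S1Z : y |: S \subset ~: Z.
  by rewrite -disjoints_subset disjoint_setUl disjoints1 yZ disjoint_sym.
apply/subsetP=> x; move: (subsetP ZS1 x) (subsetP S1Z x).
rewrite /Q R0 /frontier nbhd0 !inE; decide_membership.
Qed.

Lemma exists_connected_not_good Z : ~ good Z ->
  exists C, [/\ C \subset Z, connected_set C & ~ good C].
Proof.
have [good0 _ goodU] := good_closed.
have [n] := ubnP #|Z|; elim: n => // n IH in Z *; rewrite ltnS => Zn badZ.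
have [Z0|/set0Pn[x xZ]] := eqVneq Z set0; first by rewrite Z0 in badZ.
pose C := component Z x; have xC : x \in C := mem_component Z x.
have CZ : C \subset Z := component_sub xZ.
have [goodC|badC] := pselect (good C); last first.
  by exists C; split=> //; apply: component_connected.
have [|badD|D [DZ conD badD]] := IH (Z :\: C).
- apply: leq_trans Zn; apply: proper_card; rewrite properEneq subsetDl andbT.
  by apply/eqP=> ZE; have := xZ; rewrite -ZE inE xC.
- apply: badZ; rewrite -(setID Z C) (setIidPr CZ); apply: goodU => //.
  rewrite negbK -subset0; apply/subsetP=> y /setIP[yC /setDP[yZ yC']].
  by case/negP: yC'; apply: (subsetP (component_closed xZ)); rewrite in_setI yC.
by exists D; split=> //; apply: subset_trans DZ (subsetDl _ _).
Qed.

End Separations.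

(** * Models of rooted forests *)

Section RootedForests.
Variables (V : finType) (parent : V -> V) (depth : V -> nat).
Hypothesis depth_parent : forall v, parent v != v -> depth v = (depth (parent v)).+1.
Implicit Types (v w c : V) (W : {set V}).

Definition descendants v : {set V} := [set w | fconnect parent w v].

Definition children v : {set V} := [set c | (parent c == v) && (c != v)].

Definition forest (A : {set V}) : {set V} := \bigcup_(c in A) descendants c.

Lemma mem_descendants v : v \in descendants v.
Proof. by rewrite inE. Qed.

Lemma descendants_sub v w : w \in descendants v -> descendants w \subset descendants v.
Proof.
by rewrite inE => wv; apply/subsetP=> u; rewrite !inE => /connect_trans; apply.
Qed.

Lemma mem_descendants_parent v : v \in descendants (parent v).
Proof. by rewrite inE fconnect1. Qed.

Lemma descendants_of_parent v w : parent w \in descendants v -> w \in descendants v.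
Proof. by move/descendants_sub/subsetP; apply; apply: mem_descendants_parent. Qed.

Lemma parent_descendant v w : w \in descendants v -> w != v ->
  parent w != w /\ parent w \in descendants v.
Proof.
rewrite !inE => wv nwv; split.
  by apply: contraNneq nwv => pw; rewrite -(iter_findex wv) iter_fix.
by case/connectP: wv nwv => [[|u q] /= + ->]; rewrite ?eqxx // => /andP[/eqP <- qP] _;
  apply/connectP; exists q.
Qed.

Lemma descendants_ind v (P : V -> Prop) : P v ->
  (forall w, w \in descendants v -> parent w != w -> P (parent w) -> P w) ->
  forall w, w \in descendants v -> P w.
Proof.
move=> Pv Pparent w; have [n] := ubnP (depth w); elim: n => // n IH in w *.
rewrite ltnS => wn wv; have [->//|/(parent_descendant wv)[pw pwv]] := eqVneq w v.
by apply: Pparent wv (pw) (IH _ _ pwv); rewrite -(depth_parent pw).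
Qed.

Lemma descendants_depth v w : w \in descendants v -> depth v <= depth w.
Proof.
move: w; apply: descendants_ind => // w _ /depth_parent -> /leq_trans; apply.
exact: leqnSn.
Qed.

Lemma descendant_eq v w : w \in descendants v -> depth w <= depth v -> w = v.
Proof.
move=> wv wle; apply/eqP; apply: contraT => /(parent_descendant wv)[pw /descendants_depth].
by rewrite leqNgt -ltnS -(depth_parent pw) ltnS wle.
Qed.

Lemma parent_notin_descendants v : parent v != v -> parent v \notin descendants v.
Proof. by move=> pv; apply/negP=> /descendants_depth; rewrite (depth_parent pv) ltnn. Qed.

Lemma descendants_depth_inj u v w :
  depth u = depth v -> w \in descendants u -> w \in descendants v -> u = v.
Proof.
move=> uv; move: w; apply: descendants_ind => [uv'|w wu pw IH wv].
  by apply: descendant_eq uv' _; rewrite uv.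
have [wE|/(parent_descendant wv)[_ /IH//]] := eqVneq w v.
by rewrite -wE; apply/esym; apply: descendant_eq wu _; rewrite wE uv.
Qed.

Lemma childrenP v c : c \in children v -> parent c = v /\ parent c != c.
Proof. by rewrite inE => /andP[/eqP -> cv]; rewrite eq_sym. Qed.

Lemma child_descendants_sub v c : c \in children v -> descendants c \subset descendants v.
Proof. by case/childrenP=> <- _; apply/descendants_sub/mem_descendants_parent. Qed.

Lemma child_depth v c : c \in children v -> depth c = (depth v).+1.
Proof. by case/childrenP=> <- /depth_parent. Qed.

Lemma forest_children v : forest (children v) = descendants v :\ v.
Proof.
apply/setP=> w; apply/bigcupP/setD1P => [[c cv wc]|[nwv wv]].
  split; last exact: subsetP (child_descendants_sub cv) w wc.
  have [<- pc] := childrenP cv.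
  by apply: contraNneq (parent_notin_descendants pc) => <-.
move: w wv nwv; apply: descendants_ind => [|w _ pw IH _]; first by rewrite eqxx.
have [<-|/IH[c cv wc]] := eqVneq (parent w) v.
  by exists w; rewrite ?mem_descendants // inE eqxx eq_sym.
by exists c => //; apply: descendants_of_parent.
Qed.

Section Models.
Variable G : sgraph.
Implicit Types (B D S U : {set G}) (beta gamma : V -> {set G}).

Definition attached W B beta w : bool :=
  if parent w \in W :\ w then adjacent (beta (parent w)) (beta w)
  else beta w :&: B != set0.

(* Branch sets in [U] for the subforest induced by [W], whose roots meet [B]. *)
Definition model W U B beta : Prop :=
  packing W U beta /\ {in W, forall w, attached W B beta w}.

Lemma model_sub W U U' B beta : U \subset U' -> model W U B beta -> model W U' B beta.
Proof. by move=> UU' [packW attW]; split=> //; apply: packing_sub UU' packW. Qed.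

Lemma model_enlarge W U U' B B' beta gamma :
  model W U B beta -> packing W U' gamma ->
  {in W, forall w, beta w \subset gamma w} ->
  {in W, forall w, beta w :&: B != set0 -> gamma w :&: B' != set0} ->
  model W U' B' gamma.
Proof.
move=> [_ attW] packW sub meet; split=> // w wW; have := attW w wW; rewrite /attached.
by case: ifP => [/setD1P[_ pW]|_ /(meet w wW) //]; apply: adjacentS; apply: sub.
Qed.

Lemma model0 U B : model set0 U B (fun _ => set0).
Proof. by split; [split=> w|move=> w]; rewrite inE. Qed.

Lemma model_union W1 W2 U1 U2 B beta1 beta2 :
  [disjoint U1 & U2] -> [disjoint W1 & W2] ->
  {in W1, forall w, parent w \notin W2} -> {in W2, forall w, parent w \notin W1} ->
  model W1 U1 B beta1 -> model W2 U2 B beta2 ->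
  exists beta, model (W1 :|: W2) (U1 :|: U2) B beta.
Proof.
move=> dU dW parW1 parW2 [[con1 sub1 inj1] att1] [[con2 sub2 inj2] att2].
pose beta w := if w \in W1 then beta1 w else beta2 w.
have betaE1 w : w \in W1 -> beta w = beta1 w by rewrite /beta => ->.
have betaE2 w : w \in W2 -> beta w = beta2 w.
  by rewrite /beta => wW2; rewrite (disjointFl dW wW2).
have apart w w' x : w \in W1 -> w' \in W2 -> x \in beta1 w -> x \in beta2 w' -> False.
  move=> wW1 wW2 /(subsetP (sub1 w wW1)) xU1 /(subsetP (sub2 w' wW2)).
  by rewrite (disjointFr dU xU1).
exists beta; split; first split=> [w|w|w w' x].
- by case/setUP=> wW; rewrite ?(betaE1 _ wW) ?(betaE2 _ wW); [apply: con1|apply: con2].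
- case/setUP=> wW; rewrite ?(betaE1 _ wW) ?(betaE2 _ wW).
    exact: subset_trans (sub1 w wW) (subsetUl _ _).
  exact: subset_trans (sub2 w wW) (subsetUr _ _).
- case/setUP=> wW; rewrite ?(betaE1 _ wW) ?(betaE2 _ wW) => /setUP[] wW';
    rewrite ?(betaE1 _ wW') ?(betaE2 _ wW').
  + exact: inj1.
  + by move=> xw /(apart _ _ _ wW wW' xw).
  + by move=> xw /(apart _ _ _ wW' wW)/(_ xw).
  + exact: inj2.
move=> w /setUP[] wW; rewrite /attached !in_setD1 in_setU.
  rewrite (negPf (parW1 w wW)) orbF (betaE1 w wW); have := att1 w wW; rewrite /attached in_setD1.
  by case: ifP => // /andP[_ pW]; rewrite betaE1.
rewrite (negPf (parW2 w wW)) (betaE2 w wW); have := att2 w wW; rewrite /attached in_setD1.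
by case: ifP => // /andP[_ pW]; rewrite betaE2.
Qed.

Lemma model_add_leaf W U B D beta w :
  w \notin W -> {in W, forall v, parent v != w} -> connected_set D -> [disjoint D & U] ->
  (if parent w \in W then adjacent (beta (parent w)) D else D :&: B != set0) ->
  model W U B beta -> model (w |: W) (D :|: U) B [eta beta with w |-> D].
Proof.
move=> wW leaf conD DU attD [packW attW]; split; first exact: packing_add.
have nw v : v \in W -> (v == w) = false by move=> vW; apply: contraNF wW => /eqP <-.
move=> v /setU1P[->|vW]; rewrite /attached /=.
  rewrite eqxx in_setD1 in_setU1; case: eqVneq => [pw|_] /=; last first.
    by move: attD; case: ifP => // pW; rewrite nw.
  by move: attD; rewrite pw (negPf wW).
rewrite (nw v vW) (negPf (leaf v vW)) in_setD1 in_setU1 (negPf (leaf v vW)) /=.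
by have := attW v vW; rewrite /attached in_setD1.
Qed.

Lemma model_add_root W U B D beta v :
  v \notin W -> parent v \notin W -> {in W, forall w, parent w \in (v |: W) :\ w} ->
  connected_set D -> [disjoint D & U] -> D :&: B != set0 ->
  model W U (nbhd D) beta -> model (v |: W) (D :|: U) B [eta beta with v |-> D].
Proof.
move=> vW pvW below conD DU DB [packW attW]; split; first exact: packing_add.
have nv w : w \in W -> (w == v) = false by move=> wW; apply: contraNF vW => /eqP <-.
move=> w /setU1P[->|wW]; rewrite /attached /=.
  by rewrite eqxx in_setD1 in_setU1 (negPf pvW) orbF andNb.
rewrite (below w wW) (nv w wW); have := attW w wW; rewrite /attached.
have /setD1P[pw /setU1P[->|pW]] := below w wW.
  by rewrite eqxx in_setD1 (negPf vW) andbF /adjacent setIC.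
by rewrite nv // in_setD1 pw pW.
Qed.

Lemma model_reach W U B beta w : model W U B beta -> w \in W ->
  exists E, [/\ connected_set E, E \subset U, beta w \subset E & E :&: B != set0].
Proof.
move=> [[conW subW _] attW]; have [n] := ubnP (depth w); elim: n => // n IH in w *.
rewrite ltnS => wn wW; have := attW w wW; rewrite /attached.
case: ifP => [/setD1P[pw pW] adj|_ wB]; last first.
  by exists (beta w); split; [apply: conW|apply: subW|..].
have [|E [conE EU pE EB]] := IH (parent w) _ pW; first by rewrite -(depth_parent pw).
exists (E :|: beta w); split; last 1 first.
- by have /setI_neq0P[b bE bB] := EB; apply/setI_neq0P; exists b; rewrite // inE bE.
- apply: connected_setU_adjacent (conW w wW) _ => //; exact: adjacentS pE (subxx _) adj.
- by rewrite subUset EU subW.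
- exact: subsetUr.
Qed.

Lemma model_prolong W U1 U2 S B beta P : U1 :&: U2 \subset S ->
  model W U1 S beta -> linkage S U2 B P -> model W (U1 :|: U2) B (prolong beta S P).
Proof.
move=> U12 modelW linkP; have [packW _] := modelW.
apply: (model_enlarge modelW (packing_prolong U12 packW linkP)) => w _.
  exact: subsetUl.
exact: prolong_meets linkP.
Qed.

End Models.
End RootedForests.

(** * Embedding a forest along separations *)

Section Embedding.
Variables (V : finType) (parent : V -> V) (depth : V -> nat).
Hypothesis depth_parent : forall v, parent v != v -> depth v = (depth (parent v)).+1.
Variable G : sgraph.
Implicit Types (v w c : V) (W A : {set V}) (B C S Y Z : {set G}) (beta : V -> {set G}).
Variable good : {set G} -> Prop.
Hypothesis good_closed : hereditary_additive good.

Local Notation model := (model parent).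
Local Notation descendants := (descendants parent).
Local Notation children := (children parent).
Local Notation forest := (forest parent).

Definition unavoidable c : Prop :=
  forall C a, connected_set C -> a \in C -> ~ good C ->
    exists beta, model (descendants c) C [set a] beta.

(* By the cardinality condition, each branch set contains exactly one vertex of [S]. *)
Definition embedding Y B W Z S beta : Prop :=
  [/\ maximal_separation good Y Z S, model W (Z :|: S) B beta, #|S| = #|W|
    & {in W, forall w, beta w :&: S != set0}].

Lemma embedding_advance Y B W Z S y beta :
  maximal_separation good Y Z S -> y \in Y :\: (Z :|: S) ->
  model W (Z :|: (y |: S)) B beta -> #|y |: S| = #|W| ->
  {in W, forall w, beta w :&: (y |: S) != set0} ->
  exists Z' S' beta', embedding Y B W Z' S' beta'.
Proof.
move=> maxZ /setDP[yY yZS] modelW cardS1 meetS1.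
have [[ZY SY dZS sepZ] goodZ _] := maxZ.
have /norP[yZ yS] : ~~ ((y \in Z) || (y \in S)) by rewrite -in_setU.
have sepZ1 : separation Y Z (y |: S).
  split; rewrite // ?subUset ?sub1set ?yY //.
    by rewrite disjoint_sym disjoint_setUl disjoints1 yZ disjoint_sym.
  by apply: subset_trans sepZ _; apply/setUS/subsetUr.
have [Z' [S' [maxZ' domZ']]] := exists_maximal_separation sepZ1 goodZ.
have [sepZ' goodZ' _] := maxZ'; have [_ ZS1 S'S1] := domZ'.
pose U := (Z' :|: S') :\: Z.
have S1U : y |: S \subset U.
  have [_ _ dZS1 _] := sepZ1; rewrite disjoint_sym disjoints_subset in dZS1.
  apply/subsetP=> x; move: (subsetP ZS1 x) (subsetP dZS1 x); decide_membership.
have lk := maximal_separation_linked good_closed maxZ yZS sepZ' goodZ' domZ'.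
have [P linkP] := menger S1U lk; have [packW _] := modelW.
have meet : (Z :|: (y |: S)) :&: U \subset y |: S.
  by apply/subsetP=> x; decide_membership.
exists Z', S', (prolong beta (y |: S) P); split=> //.
- apply: (@model_sub _ _ _ _ (Z :|: (y |: S) :|: U)).
    by rewrite subUset ZS1 subsetDl.
  by apply: model_enlarge modelW (packing_prolong meet packW linkP) _ _ => w _;
    rewrite /prolong ?subsetUl // setIUl setU_eq0 negb_and => ->.
- apply/eqP; rewrite -cardS1 eqn_leq S'S1; apply: leq_trans (linked_leq_card lk) _.
  exact/subset_leq_card/subsetIr.
- by move=> w /meetS1; apply: prolong_meets linkP.
Qed.

Lemma embedding_add Y B W Z S beta w y :
  embedding Y B W Z S beta -> w \notin W -> {in W, forall v, parent v != w} ->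
  y \in Y :\: (Z :|: S) ->
  (if parent w \in W then adjacent (beta (parent w)) [set y] else y \in B) ->
  exists Z' S' beta', embedding Y B (w |: W) Z' S' beta'.
Proof.
move=> [maxZ modelW cardS meetS] wW leaf yYZS att.
have /setDP[_ yZS] := yYZS.
have /norP[yZ yS] : ~~ ((y \in Z) || (y \in S)) by rewrite -in_setU.
apply: (@embedding_advance _ _ _ _ _ y [eta beta with w |-> [set y]] maxZ) => //.
- rewrite setUCA; apply: model_add_leaf modelW => //; first exact: connected_set1.
    by rewrite disjoints1.
  by case: ifP att => // _ yB; apply/setI_neq0P; exists y; rewrite ?set11.
- by rewrite !cardsU1 yS wW cardS.
- move=> v /setU1P[->|vW] /=.
    by rewrite eqxx; apply/setI_neq0P; exists y; rewrite ?set11 ?setU11.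
  have /setI_neq0P[s sv sS] := meetS v vW; rewrite ifN; last by apply: contraNneq wW => <-.
  by apply/setI_neq0P; exists s; rewrite // inE sS orbT.
Qed.

(* If all neighbours of [s] lie in [Z :|: S], then [s] could move from [S] to [Z], so
   by maximality [s |: Z] is not good. *)
Lemma embedding_stuck Y B W Z S beta c w s :
  embedding Y B W Z S beta -> unavoidable c ->
  w \in W -> s \in beta w -> s \in S -> nbhd [set s] :&: Y \subset Z :|: S ->
  exists gamma, model (descendants c) (Z :|: S) B gamma.
Proof.
move=> [[[ZY SY dZS sepZ] goodZ maxZ] modelW _ _] unav wW sw sS Ns.
have sZ : s \notin Z by rewrite (disjointFl dZS sS).
have badZ : ~ good (s |: Z).
  move=> goodsZ; suff ZE : s |: Z = Z by rewrite -ZE setU11 in sZ.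
  apply: (maxZ _ (S :\ s)) goodsZ _; split; rewrite ?subsetUr //.
  - by rewrite subUset sub1set (subsetP SY).
  - exact: subset_trans (subsetDl _ _) SY.
  - rewrite disjoint_setUl disjoints1 !inE eqxx /=.
    exact: disjointWr (subsetDl _ _) dZS.
  - by rewrite setUAC setD1K // nbhdU setIUl subUset setUC Ns sepZ.
  - by rewrite setUAC setD1K // setUC.
  - exact/subset_leq_card/subsetDl.
have [C [CsZ conC badC]] := exists_connected_not_good good_closed badZ.
have sC : s \in C.
  apply: contraT => sC; case: badC; have [_ good_sub _] := good_closed; apply: good_sub goodZ.
  by rewrite -(setU1K sZ) subsetD1 CsZ.
have CZS : C \subset Z :|: S.
  by apply: subset_trans CsZ _; rewrite subUset sub1set inE sS orbT subsetUl.
have [E [conE EZS wE /setI_neq0P[b bE bB]]] := model_reach depth_parent modelW wW.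
have [|D [a [conD DE bD DC]]] := connected_set_approach (C := C) conE bE.
  by apply/setI_neq0P; exists s => //; apply: subsetP wE s sw.
have /setIP[aD aC] : a \in D :&: C by rewrite DC set11.
have [gamma modelC] := unav C a conC aC badC.
have linkD : linkage [set a] D B (fun _ => D).
  split=> [|_ /set1P ->]; last by split=> //; apply/setI_neq0P; exists b.
  by split=> // w' w'' x /set1P -> /set1P ->.
exists (prolong gamma [set a] (fun _ => D)).
apply: (model_sub (U := C :|: D)); first by rewrite subUset CZS (subset_trans DE).
by apply: model_prolong modelC linkD; rewrite setIC DC.
Qed.

Definition initial c W : Prop :=
  W \subset descendants c /\
  {in W & descendants c :\: W, forall v w, depth v <= depth w}.

Lemma initial_next c W : initial c W -> W != descendants c ->
  exists w, [/\ w \notin W, {in W, forall v, parent v != w} & initial c (w |: W)].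
Proof.
move=> [Wc Wle] nWc; have [|w0 w0c w0W] := subsetPn (_ : ~~ (descendants c \subset W)).
  by apply: contra nWc; rewrite eqEsubset Wc.
have w0P : w0 \in descendants c :\: W by rewrite inE w0W.
have [w wcW wmin] := arg_minnP (P := [in descendants c :\: W]) depth w0P.
have /setDP[wc wW] := wcW; exists w; split=> //.
  move=> v vW; apply: contraTneq (Wle v w vW wcW) => pv; rewrite -ltnNge -pv.
  by rewrite -depth_parent // pv; apply: contraNneq wW => ->.
split; first by rewrite subUset sub1set wc.
move=> v u /setU1P vwW /setDP[uc]; rewrite in_setU1 negb_or => /andP[_ uW].
have ucW : u \in descendants c :\: W by rewrite inE uW.
by case: vwW => [->|vW]; [apply: wmin|apply: Wle].
Qed.

Lemma embed_tree_or_separate Y B c : unavoidable c ->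
  exists Z S, [/\ separation Y Z S, good Z, #|S| <= #|descendants c| &
    (#|S| < #|descendants c| /\ Y :&: B \subset Z :|: S) \/
    exists beta, model (descendants c) (Z :|: S) B beta].
Proof.
move=> unav; have [good0 _ _] := good_closed.
pose embeddable W := `[< initial c W /\ exists Z S beta, embedding Y B W Z S beta >].
have embeddable0 : embeddable set0.
  apply/asboolP; split; first by split=> [|v w]; rewrite ?sub0set ?inE.
  have [Z [S [maxZ [_ _]]]] := exists_maximal_separation (separation0 Y) good0.
  rewrite cards0 leqn0 cards_eq0 => /eqP S0; exists Z, S, (fun _ => set0).
  by split=> // [||w]; rewrite ?S0 ?cards0 ?inE //; apply: model0.
have [W /asboolP[initW [Z [S [beta emb]]]] maxW] :=
  arg_maxnP (fun W : {set V} => #|W|) embeddable0.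
have [[sepZ goodZ _] modelW cardS meetS] := emb; exists Z, S.
have [Wc _] := initW; split=> //; first by rewrite cardS subset_leq_card.
have [WE|nWc] := eqVneq W (descendants c); first by right; exists beta; rewrite -WE.
have [w [wW leaf initwW]] := initial_next initW nWc.
have no_step y : y \in Y :\: (Z :|: S) ->
    ~~ (if parent w \in W then adjacent (beta (parent w)) [set y] else y \in B).
  move=> yYZS; apply/negP=> att; have embw := embedding_add emb wW leaf yYZS att.
  by have := maxW (w |: W) (asboolT (conj initwW embw)); rewrite /= cardsU1 wW ltnn.
have [pW|pW] := boolP (parent w \in W); last first.
  left; rewrite cardS; split; first by apply: proper_card; rewrite properEneq nWc.
  apply/subsetP=> y /setIP[yY yB]; apply: contraTT yB => yZS.
  by have := no_step y; rewrite (negPf pW); apply; rewrite in_setD yZS.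
right; have /setI_neq0P[s sp sS] := meetS _ pW.
apply: (embedding_stuck emb unav pW sp sS).
apply/subsetP=> y /setIP[/nbhdP[_ /set1P -> sy] yY]; apply: contraT => yZS.
have := no_step y; rewrite pW in_setD yZS yY => /(_ isT)/negP[].
by apply/adjacentP; exists s, y; rewrite set11.
Qed.

Lemma embed_forest_or_separate v A Y B :
  A \subset children v -> {in A, forall c, unavoidable c} ->
  (exists beta, model (forest A) Y B beta) \/
  exists Z S, [/\ separation Y Z S, good Z, #|S| < #|forest A| & Y :&: B \subset Z :|: S].
Proof.
have [n] := ubnP #|A|; elim: n => // n IH in A Y *; rewrite ltnS => An Av unav.
have [A0|/set0Pn[c cA]] := eqVneq A set0.
  by left; exists (fun _ => set0); rewrite A0 /forest big_set0; apply: model0.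
have cv := subsetP Av c cA; pose A' := A :\ c; have A'A : A' \subset A := subsetDl _ _.
have forestE : forest A = descendants c :|: forest A' by rewrite /forest (big_setD1 c).
have apart w : w \in descendants c -> w \in forest A' -> False.
  move=> wc /bigcupP[c' /setD1P[cc' c'A] wc']; case/eqP: cc'.
  apply: (descendants_depth_inj depth_parent) wc' wc.
  by rewrite (child_depth depth_parent cv) (child_depth depth_parent (subsetP Av c' c'A)).
have dcA' : [disjoint descendants c & forest A'].
  by rewrite -setI_eq0 -subset0; apply/subsetP=> w /setIP[wc /(apart w wc)].
have cardA : #|forest A| = #|descendants c| + #|forest A'|.
  by rewrite forestE cardsU disjoint_setI0 // cards0 subn0.
have [Z [S [sepZ goodZ cardS]]] := embed_tree_or_separate Y B (unav c cA).
case=> [[ltS YB]|[beta modelc]].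
  by right; exists Z, S; split=> //; rewrite cardA (leq_trans ltS) ?leq_addr.
have [|||[beta' modelA']|[Z' [S' [sepZ' goodZ' cardS' YB']]]] := IH A' (Y :\: (Z :|: S)).
- by apply: leq_trans An; rewrite (cardsD1 c A) cA.
- exact: subset_trans Av.
- by move=> c' /(subsetP A'A)/unav.
- left; rewrite forestE; have [ZY SY _ _] := sepZ.
  have [|w wc|w wA'|gamma modelA] := model_union _ dcA' _ _ modelc modelA'.
  + exact: disjoint_setDr.
  + apply/negP=> /bigcupP[c' c'A pw]; apply: (apart w wc).
    by apply/bigcupP; exists c' => //; apply: descendants_of_parent pw.
  + apply/negP=> /descendants_of_parent wc; exact: apart wc wA'.
  by exists gamma; apply: model_sub modelA; rewrite !subUset ZY SY subsetDl.
right; exists (Z :|: Z'), (S :|: S'); split.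
- exact: separationU.
- have [_ _ goodU] := good_closed; apply: goodU => //; rewrite negbK.
  have [_ _ _ NZ] := sepZ; have [Z'Y _ _ _] := sepZ'.
  rewrite -subset0; apply/subsetP=> x; move: (subsetP NZ x) (subsetP Z'Y x); decide_membership.
- by rewrite cardA; apply: leq_ltn_trans (leq_card_setU _ _) _; rewrite -addnS leq_add.
- by apply/subsetP=> x; move: (subsetP YB' x); decide_membership.
Qed.

End Embedding.

(** * Sweeps and pathwidth *)

Section Sweeps.
Variables (G : sgraph) (m : nat).
Implicit Types (P Q S U X Y Z : {set G}) (F : seq {set G}).

(* The parts of a partition of [P] are introduced one by one and forgotten later, with
   at most [k] parts in memory at any time; [F] is the final content of the memory. *)
Inductive swept (k : nat) : {set G} -> seq {set G} -> Prop :=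
| Swept_nil : swept k set0 [::]
| Swept_introduce P F X : swept k P F -> size F < k -> #|X| <= m -> [disjoint P & X] ->
    nbhd X :&: P \subset \bigcup_(Y <- F) Y -> swept k (P :|: X) (X :: F)
| Swept_forget P F F' : swept k P F -> subseq F' F -> swept k P F'.

Lemma swept_setI k P F Q : swept k P F -> swept k (P :&: Q) [seq X :&: Q | X <- F].
Proof.
elim=> {P F} [|P F X _ IH sizeF Xm PX NX|P F F' _ IH F'F].
- by rewrite set0I; apply: Swept_nil.
- rewrite setIUl; apply: Swept_introduce IH _ _ _ _.
  + by rewrite size_map.
  + exact: leq_trans (subset_leq_card (subsetIl _ _)) Xm.
  + exact: disjointW (subsetIl _ _) (subsetIl _ _) PX.
  + rewrite big_map -big_distrl /= setIA; apply: setSI; apply: subset_trans NX.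
    exact: setSI (nbhdS (subsetIl _ _)).
- exact: Swept_forget IH (map_subseq _ F'F).
Qed.

Lemma swept_cat k k' Z F P F0 :
  swept k Z F -> swept k' P F0 -> k + size F0 <= k' -> [disjoint P & Z] ->
  nbhd Z :&: P \subset \bigcup_(Y <- F0) Y -> swept k' (P :|: Z) (F ++ F0).
Proof.
move=> + sweptP kk'; elim=> {Z F} [|Z F X _ IH sizeF Xm ZX NX|Z F F' _ IH F'F].
- by rewrite setU0.
- rewrite disjoint_setUr nbhdU setIUl subUset => /andP[PZ PX] /andP[NZ NXP].
  rewrite setUA; apply: Swept_introduce => //.
  + exact: IH.
  + by rewrite size_cat (leq_trans _ kk') // ltn_add2r.
  + by rewrite disjoint_setUl PX.
  + rewrite setIUr subUset big_cat /= (subset_trans NXP) ?subsetUr //.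
    by rewrite (subset_trans NX) ?subsetUl.
- by move=> PZ NZ; apply: Swept_forget (IH PZ NZ) (cat_subseq F'F (subseq_refl _)).
Qed.

Definition decomposable k U : Prop := swept k U [::].

Lemma swept_decomposable k P F : swept k P F -> decomposable k P.
Proof. by move=> sweptP; apply: Swept_forget sweptP (sub0seq F). Qed.

Lemma decomposable_hereditary_additive k : hereditary_additive (decomposable k).
Proof.
split=> [|Z Z' Z'Z sweptZ|Z Z' ZZ' sweptZ sweptZ']; first exact: Swept_nil.
  by rewrite -(setIidPr Z'Z); apply: swept_decomposable (swept_setI Z' sweptZ).
have ZE : Z :|: Z' = Z :|: (Z' :\: Z).
  by apply/setP=> x; rewrite !inE; case: (x \in Z).
rewrite ZE; apply: (@swept_cat k k _ [::] Z [::]) => //.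
- rewrite setDE; exact: swept_decomposable (swept_setI _ sweptZ').
- by rewrite addn0.
- exact: disjoint_setDr.
apply: subset_trans (setSI _ (nbhdS (subsetDl _ _))) _.
by move: ZZ'; rewrite adjacent_sym /adjacent negbK => /eqP ->; apply: sub0set.
Qed.

Lemma swept_extend k P S Z S' :
  swept k.+2 P [:: S] -> decomposable k Z -> #|S'| <= m ->
  [disjoint P & Z :|: S'] -> [disjoint Z & S'] -> nbhd (Z :|: S') :&: P \subset S ->
  swept k.+2 (P :|: S' :|: Z) [:: S'].
Proof.
move=> sweptP decZ S'm; rewrite disjoint_setUr nbhdU setIUl subUset.
move=> /andP[PZ PS'] ZS' /andP[NZ NS'].
have sweptPS' : swept k.+2 (P :|: S') [:: S'; S].
  by apply: Swept_introduce; rewrite // ?big_seq1.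
have sweptD : swept k.+2 (P :|: S' :|: Z) ([::] ++ [:: S'; S]).
  apply: swept_cat decZ sweptPS' _ _ _; first by rewrite addn2.
    by rewrite disjoint_setUl PZ disjoint_sym.
  by rewrite big_cons big_seq1 setIUr setUC setUSS // subsetIr.
by apply: Swept_forget sweptD _; rewrite /= eqxx.
Qed.

(* The parts are numbered [0, ..., n.-1] in their order of introduction; the part [i]
   is in memory during the interval [[i, stop i]]. *)
Definition interval_layout k P n (part : G -> nat) (stop : nat -> nat) : Prop :=
  [/\ {in P, forall x, part x < n} /\ (forall i, i < n -> i <= stop i < n),
      forall i, #|[set x in P | part x == i]| <= m,
      {in P &, forall x y, sedge x y -> part x <= stop (part y)}
    & forall t, exists2 s : seq nat, size s <= k &
        forall i, i < n -> i <= t <= stop i -> i \in s].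

Lemma interval_layout_introduce k P n part stop fs X :
  interval_layout k P n part stop -> {in fs, forall i, (stop i).+1 = n} ->
  size fs < k -> #|X| <= m -> [disjoint P & X] ->
  {in nbhd X :&: P, forall x, part x \in fs} ->
  interval_layout k (P :|: X) n.+1 (fun x => if x \in X then n else part x)
    (fun i => if i \in n :: fs then n else stop i).
Proof.
move=> [[partn stopn] partm edge bag] stopfs sizefs Xm PX NX.
set stop' := fun i => if i \in n :: fs then _ else _.
have stop'n i : i \in n :: fs -> stop' i = n by rewrite /stop' => ->.
have stop_le i : i < n -> stop i <= stop' i <= n.
  by rewrite /stop'; case: ifP => _ /stopn/andP[_ /ltnW ->]; rewrite leqnn.
have PXP x : x \in P :|: X -> x \notin X -> x \in P by rewrite inE => /orP[->|->].
split=> [|i|x y xPX yPX xy|t].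
- split=> [x /PXP xP|i]; first by case: ifPn => // /xP/partn/leqW.
  rewrite ltnS leq_eqVlt => /orP[/eqP ->|lt_in]; first by rewrite stop'n ?mem_head ?leqnn.
  have /andP[le_stop] := stop_le i lt_in; rewrite ltnS => ->; rewrite andbT.
  by have /andP[le_i _] := stopn i lt_in; apply: leq_trans le_stop.
- have [->|nin] := eqVneq i n.
    apply: leq_trans Xm; apply/subset_leq_card/subsetP=> x; rewrite inE => /andP[/PXP xP].
    by case: ifPn => // /xP/partn; rewrite ltn_neqAle => /andP[/negPf ->].
  apply: leq_trans (partm i); apply/subset_leq_card/subsetP=> x; rewrite !inE => /andP[].
  by rewrite -in_setU => /PXP xP; case: ifPn => [_|/xP -> //]; rewrite eq_sym (negPf nin).
- case: ifPn => [xX|/(PXP x xPX) xP]; case: ifPn => [yX|/(PXP y yPX) yP].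
  + by rewrite stop'n ?mem_head.
  + rewrite stop'n // inE NX ?orbT // inE yP andbT; apply/nbhdP; exists x => //.
  + by rewrite stop'n ?mem_head // ltnW ?partn.
  + apply: leq_trans (edge x y xP yP xy) _.
    by case/andP: (stop_le _ (partn y yP)).
- have [tn|nt] := ltnP t n.
    have [s sk bag_s] := bag t; exists s => // i _ /andP[le_it le_t_stop].
    have lt_in := leq_ltn_trans le_it tn; apply: bag_s => //; rewrite le_it /=.
    move: le_t_stop; rewrite /stop' inE (ltn_eqF lt_in) /=.
    by case: ifP => // /stopfs <- in tn *; rewrite -ltnS.
  exists (n :: fs) => // i; rewrite ltnS leq_eqVlt => /orP[/eqP -> _|lt_in /andP[_]].
    exact: mem_head.
  rewrite /stop'; case: ifP => // _ /(leq_trans nt); rewrite leqNgt.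
  by have /andP[_ ->] := stopn i lt_in.
Qed.

Lemma swept_interval_layout k P F : swept k P F ->
  exists n part stop (fs : seq nat), [/\ interval_layout k P n part stop,
    F = [seq [set x in P | part x == i] | i <- fs]
    & {in fs, forall i, i < n /\ (stop i).+1 = n}].
Proof.
elim=> {P F} [|P F X _ [n [part [stop [fs [layP FE fsn]]]]] sizeF Xm PX NX|].
- exists 0, (fun _ => 0), (fun _ => 0), [::]; split=> //; split=> [|i|x|t].
  + by split=> // x; rewrite inE.
  + by rewrite (_ : [set _ in _ | _] = set0) ?cards0 //; apply/setP=> x; rewrite !inE.
  + by rewrite inE.
  + by exists [::].
- have [[partn _] _ _ _] := layP.
  exists n.+1, (fun x => if x \in X then n else part x),
    (fun i => if i \in n :: fs then n else stop i), (n :: fs); split.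
  + apply: interval_layout_introduce => //; first by move=> i /fsn[].
      by move: sizeF; rewrite FE size_map.
    move=> x /(subsetP NX); rewrite FE big_map big_seq.
    elim/big_ind: _ => [|A B IHA IHB /setUP[/IHA|/IHB] //|i ifs].
      by rewrite inE.
    by rewrite inE => /andP[_ /eqP ->].
  + rewrite FE /=; congr cons; [|apply/eq_in_map=> i /fsn[lt_in _]]; apply/setP=> x.
      rewrite !inE; case: ifP => [_|_]; rewrite ?eqxx ?orbT // orbF.
      by apply/esym/negP=> /andP[/partn + /eqP xn]; rewrite xn ltnn.
    rewrite !inE; case: ifPn => xX; last by rewrite orbF.
    by rewrite (disjointFl PX xX) (gtn_eqF lt_in).
  + by move=> i ifs; rewrite ifs; split=> //; case/predU1P: ifs => [->|/fsn[/leqW]].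
- move=> P F F' _ [n [part [stop [fs [layP -> fsn]]]]] /subseqP[b _ ->].
  exists n, part, stop, (mask b fs); split=> //; first by rewrite map_mask.
  by move=> i /mem_mask/fsn.
Qed.

End Sweeps.

Lemma pathwidth_leq (H : sgraph) (s : seq {set H}) k :
  path_decomposition s -> (forall B, B \in s -> #|B| <= k) -> pathwidth H <= k.-1.
Proof.
move=> decs sk; rewrite /pathwidth; case: ex_minnP => w _ wmin.
apply: (leq_trans (wmin (width s) _)); first by apply/asboolP; exists s.
rewrite /width -!subn1 leq_sub2r //.
by apply/bigmax_leqP_seq => B Bs _; apply: sk.
Qed.

Section IntervalGraphs.
Variables (I : finType) (start stop : I -> nat).

Definition interval_rel : rel I :=
  fun i j => [&& i != j, start i <= stop j & start j <= stop i].

Lemma interval_rel_sym : symmetric interval_rel.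
Proof. by move=> i j; rewrite /interval_rel eq_sym; congr andb; apply: andbC. Qed.

Lemma interval_rel_irrefl : irreflexive interval_rel.
Proof. by move=> i; rewrite /interval_rel eqxx. Qed.

Definition interval_graph : sgraph := SGraph interval_rel_sym interval_rel_irrefl.

Lemma pathwidth_interval_graph k : (forall i, start i <= stop i) ->
  (forall t, #|[set i | start i <= t <= stop i]| <= k) -> pathwidth interval_graph <= k.-1.
Proof.
move=> le_start_stop bagk.
pose bag t : {set interval_graph} := [set i | start i <= t <= stop i].
pose n := (\max_i stop i).+1; have stopn i : stop i < n by rewrite ltnS leq_bigmax.
have bagP t : t < n -> bag t \in mkseq bag n by move=> tn; rewrite map_f // mem_iota.
apply: (pathwidth_leq (s := mkseq bag n)) => [|_ /mapP[t _ ->]]; last exact: bagk.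
split=> [i|i j /and3P[_ ij ji]|i t u v /andP[tu uv]].
- by exists (bag (stop i)); rewrite ?bagP // inE leqnn le_start_stop.
- exists (bag (maxn (start i) (start j))).
    by apply: bagP; rewrite gtn_max !(leq_ltn_trans (le_start_stop _)).
  by rewrite !inE leq_maxl leq_maxr !geq_max ij ji !le_start_stop.
- rewrite size_mkseq => vn; rewrite !nth_mkseq ?inE; lia.
Qed.

End IntervalGraphs.

Lemma contained_inj (G J : sgraph) (f : G -> J) :
  injective f -> (forall x y, sedge x y -> sedge (f x) (f y)) -> contained G J.
Proof.
move=> finj fE.
pose E : rel J := fun u v => [exists x, exists y, [&& u == f x, v == f y & sedge x y]].
have EP u v : reflect (exists x y, [/\ u = f x, v = f y & sedge x y]) (E u v).
  apply: (iffP existsP) => [[x /existsP[y /and3P[/eqP-> /eqP-> xy]]]|[x [y [-> -> xy]]]].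
    by exists x, y.
  by exists x; apply/existsP; exists y; rewrite !eqxx.
have Esym : symmetric E.
  by move=> u v; apply/EP/EP=> -[x [y [-> -> xy]]]; exists y, x; rewrite sedge_sym.
have EsubP u v : E u v -> [/\ u \in f @: setT, v \in f @: setT & sedge u v].
  by case/EP=> x [y [-> -> xy]]; rewrite !imset_f ?inE //; split=> //; apply: fE.
exists (Subgraph Esym EsubP).
have fin x : f x \in f @: setT by rewrite imset_f ?inE.
exists (fun x => exist _ (f x) (fin x)); split.
  apply: inj_card_bij; first by move=> x y [] /finj.
  by rewrite card_sig (card_imset _ finj) cardsT.
move=> x y; rewrite /= /subgraph_rel /=; apply/EP/idP => [[x' [y' [/finj -> /finj ->]]]//|xy].
by exists x, y.
Qed.

Lemma contained_strong_product (G H : sgraph) m (f : G -> H) :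
  (forall x y, sedge x y -> (f x == f y) || sedge (f x) (f y)) ->
  (forall u, #|[set x | f x == u]| <= m) ->
  contained G (strong_product H (complete_graph m)).
Proof.
move=> f_edge fibre; pose fib x := enum [set y | f y == f x].
have mem_fib x : x \in fib x by rewrite mem_enum inE.
have fib_index x : index x (fib x) < m.
  by apply: leq_trans (fibre (f x)); rewrite cardE index_mem.
pose g x : strong_product H (complete_graph m) := (f x, Ordinal (fib_index x)).
have g_inj : injective g.
  move=> x y [fxy]; have fibE : fib x = fib y by rewrite /fib fxy.
  by rewrite fibE => ixy; rewrite -(nth_index x (mem_fib y)) -ixy nth_index -?fibE.
apply: (contained_inj g_inj) => x y xy.
have gxy : g x != g y.
  by rewrite (inj_eq g_inj); apply: contraTneq xy => ->; rewrite sedge_irrefl.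
by rewrite /= /strong_product_rel gxy f_edge //= /complete_rel orbN.
Qed.

Lemma decomposable_contained (G : sgraph) m k : decomposable m k [set: G] ->
  exists H : sgraph, pathwidth H <= k.-1 /\ contained G (strong_product H (complete_graph m)).
Proof.
case/swept_interval_layout=> n [part [stop [_ [[[partn stopn] partm edge bag] _ _]]]].
have {}partn x : part x < n by apply: partn; rewrite inE.
pose H := interval_graph (fun i : 'I_n => i : nat) (fun i : 'I_n => stop i).
exists H; split.
  apply: pathwidth_interval_graph => [i|t]; first by case/andP: (stopn i (ltn_ord i)).
  have [s sk sP] := bag t; apply: leq_trans sk; rewrite cardE -(size_map val).
  apply: uniq_leq_size; first by rewrite (map_inj_uniq val_inj) enum_uniq.
  by move=> _ /mapP[i + ->]; rewrite mem_enum inE; apply: sP.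
apply: (@contained_strong_product _ H m (fun x => Ordinal (partn x))) => [x y xy|i].
  case: eqVneq => //= nxy; apply/and3P; split=> //=; apply: edge; rewrite ?inE //.
  by rewrite sedge_sym.
apply: leq_trans (partm i); apply/subset_leq_card/subsetP=> x.
by rewrite !inE -val_eqE.
Qed.

(** * Sweeping around a missing rooted tree *)

Section RootedSweep.
Variables (V : finType) (parent : V -> V) (depth : V -> nat).
Hypothesis depth_parent : forall v, parent v != v -> depth v = (depth (parent v)).+1.
Variables (G : sgraph) (m : nat).
Hypothesis m_gt0 : 0 < m.
Implicit Types (v w c : V) (C P S : {set G}) (a : G).

Local Notation model := (model parent).
Local Notation descendants := (descendants parent).
Local Notation children := (children parent).
Local Notation unavoidable k := (unavoidable parent (@decomposable G m k)).

Lemma model_over_children v C P a beta :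
  connected_set P -> P \subset C -> a \in P ->
  model (forest parent (children v)) (C :\: P) (nbhd P) beta ->
  exists gamma, model (descendants v) C [set a] gamma.
Proof.
move=> conP PC aP; rewrite (forest_children depth_parent) => modelW.
rewrite -(setD1K (mem_descendants parent v)) -(setID C P) (setIidPr PC).
eexists; apply: model_add_root modelW => //.
- by rewrite in_setD1 eqxx.
- by apply/negP=> /setD1P[pv]; apply/negP/(parent_notin_descendants depth_parent).
- move=> w /setD1P[wv wd]; rewrite setD1K ?mem_descendants // in_setD1.
  by have [-> ->] := parent_descendant wd wv.
- exact: disjoint_setDr.
- by apply/setI_neq0P; exists a; rewrite ?set11.
Qed.

Definition sweep_state k C a P S : Prop :=
  [/\ connected_set P, a \in P, P \subset C, swept m k P [:: S]
    & nbhd (C :\: P) :&: P \subset S].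

(* A model below the children of [v] rooted in the neighbourhood of [P] would extend to
   [v] by taking [P] as its branch set, so [C :\: P] has a separation instead. *)
Lemma sweep_step h v C a P S :
  {in children v, forall c, unavoidable h c} -> #|descendants v| <= m.+2 ->
  (forall beta, ~ model (descendants v) C [set a] beta) ->
  sweep_state h.+2 C a P S -> adjacent P (C :\: P) ->
  exists P' S', sweep_state h.+2 C a P' S' /\ P \proper P'.
Proof.
move=> unav cardv nomodel [conP aP PC sweptP NP] /setI_neq0P[y0 y0N y0CP].
have [[beta modelY]|[Z [S' [[ZY S'Y ZS' NZ] decZ cardS' YN]]]] := embed_forest_or_separate
    depth_parent (decomposable_hereditary_additive G m h) (C :\: P) (nbhd P) (subxx _) unav.
  by have [gamma modelC] := model_over_children conP PC aP modelY; case: (nomodel gamma).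
have {}cardS' : #|S'| <= m.
  rewrite -ltnS; apply: leq_trans cardS' _; rewrite (forest_children depth_parent).
  by move: cardv; rewrite (cardsD1 v) mem_descendants.
have ZS'CP : Z :|: S' \subset C :\: P by rewrite subUset ZY.
pose D := P :|: S' :|: Z; have aD : a \in D by rewrite !inE aP.
pose Q := component D a; have aQ : a \in Q := mem_component D a.
have QD : Q \subset D := component_sub aD.
have /subsetP closedQ : nbhd Q :&: D \subset Q := component_closed aD.
have PQ : P \subset Q.
  apply: connected_set_sub conP aP aQ _; apply: subset_trans (component_closed aD).
  by apply: setIS; rewrite /D -setUA subsetUl.
have NPZ x : x \in nbhd (P :|: Z) -> x \in C :\: P -> x \in D.
  move: (subsetP NZ x) (subsetP YN x); rewrite nbhdU; decide_membership.
have sweptD : swept m h.+2 D [:: S'].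
  apply: swept_extend sweptP decZ cardS' _ ZS' (subset_trans (setSI _ (nbhdS ZS'CP)) NP).
  exact: disjointWr ZS'CP (disjoint_setDr _ _).
have sweptQ : swept m h.+2 Q [:: S' :&: Q].
  by have := swept_setI Q sweptD; rewrite (setIidPr QD).
exists Q, (S' :&: Q); split; first split=> //.
- exact: component_connected.
- apply: subset_trans QD _; rewrite /D -setUA subUset PC setUC.
  exact: subset_trans ZS'CP (subsetDl _ _).
- apply/subsetP=> y /setIP[/nbhdP[x /setDP[xC xQ] xy] yQ]; rewrite in_setI yQ andbT.
  apply: contraTT (subsetP QD y yQ) => yS'; rewrite /D setUAC in_setU negb_or yS' andbT.
  apply: contra (xQ) => yPZ; apply: closedQ; rewrite in_setI.
  have -> : x \in nbhd Q by apply/nbhdP; exists y; rewrite // sedge_sym.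
  apply: NPZ; first by apply/nbhdP; exists y; rewrite // sedge_sym.
  by rewrite in_setD xC andbT; apply: contra xQ => /(subsetP PQ).
- rewrite properE PQ; apply/subsetPn; exists y0; last by case/setDP: y0CP.
  apply: closedQ; rewrite in_setI (subsetP (nbhdS PQ)) //=; apply: NPZ y0CP.
  exact: subsetP (nbhdS (subsetUl _ _)) _ y0N.
Qed.

Lemma sweep_decomposable h v C a :
  {in children v, forall c, unavoidable h c} -> #|descendants v| <= m.+2 ->
  (forall beta, ~ model (descendants v) C [set a] beta) ->
  connected_set C -> a \in C -> decomposable m h.+2 C.
Proof.
move=> unav cardv nomodel conC aC.
pose sweepable P := `[< exists S, sweep_state h.+2 C a P S >].
have sweepable1 : sweepable [set a].
  apply/asboolP; exists [set a]; split; rewrite ?set11 ?sub1set ?subsetIr //.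
    exact: connected_set1.
  rewrite -[X in swept _ _ X]set0U; apply: Swept_introduce => //.
  - exact: Swept_nil.
  - by rewrite cards1.
  - by rewrite -setI_eq0 set0I.
  - by rewrite setI0 sub0set.
have [P /asboolP[S stP] maxP] := arg_maxnP (fun P : {set G} => #|P|) sweepable1.
have [conP aP PC sweptP _] := stP.
have [adjP|] := boolP (adjacent P (C :\: P)).
  have [P' [S' [stP' /proper_card]]] := sweep_step unav cardv nomodel stP adjP.
  by rewrite ltnNge => /negP[]; apply/maxP/asboolP; exists S'.
rewrite negbK => /eqP NP0; suff -> : C = P by apply: swept_decomposable sweptP.
apply/eqP; rewrite eqEsubset PC andbT; apply: connected_set_sub conC aC aP _.
by apply/subsetP=> x; have /setP/(_ x) := NP0; rewrite !inE; case: (x \in P) => //= ->.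
Qed.

Lemma unavoidable_of_height h v :
  {in descendants v, forall w, depth w <= depth v + h} -> #|descendants v| <= m.+2 ->
  unavoidable (2 * h) v.
Proof.
elim: h v => [|h IH] v height cardv C a conC aC badC.
  have descE : descendants v = [set v].
    apply/setP=> w; rewrite in_set1; apply/idP/eqP => [wv|->]; last exact: mem_descendants.
    by apply: (descendant_eq depth_parent wv); rewrite -[depth v]addn0 height.
  exists (fun _ => [set a]); rewrite descE; split; first split.
  - by move=> w _; apply: connected_set1.
  - by move=> w _; rewrite sub1set.
  - by move=> w w' x /set1P -> /set1P ->.
  - move=> w /set1P ->; rewrite /attached setDv inE setIid.
    by apply/set0Pn; exists a; rewrite set11.
apply: contrapT => nomodel; apply: badC; rewrite mulnS.
apply: sweep_decomposable (cardv) _ conC aC => [c cv|beta modelC]; last by case: nomodel; exists beta.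
have cv_sub := child_descendants_sub cv; apply: IH => [w wc|].
  by rewrite (child_depth depth_parent cv) addSnnS height // (subsetP cv_sub).
exact: leq_trans (subset_leq_card cv_sub) cardv.
Qed.

End RootedSweep.

(** * Trees *)

Section Distance.
Variable T : sgraph.
Implicit Types (r x y v : T) (q : seq T).

Lemma dist_leq_path x q : path (@sedge T) x q -> size q < #|T| -> dist x (last x q) <= size q.
Proof.
move=> qP qT; rewrite /dist -minEnat -leEnat.
apply: (bigmin_le_cond (j := Ordinal qT) _ (@nat_of_ord _)).
by apply/existsP; exists (in_tuple q); rewrite qP /= eqxx.
Qed.

Lemma dist_leq_card x y : dist x y <= #|T|.
Proof. by rewrite /dist -minEnat -leEnat; apply: bigmin_le_id. Qed.

Lemma shortest_path x y : connect (@sedge T) x y ->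
  exists q, [/\ path (@sedge T) x q, last x q = y, size q = dist x y & size q < #|T|].
Proof.
case/connectP=> q0 q0P yE; case/shortenP: q0P yE => q qP q_uniq _ ->.
have qT : size q < #|T| by have := max_card (mem (x :: q)); rewrite (card_uniqP q_uniq).
have [|i _|i /existsP[p /andP[pP /eqP plast]] distE] := @eq_bigmin _ _ _ #|T| (Ordinal qT)
  (fun n : 'I_#|T| => [exists p : n.-tuple T, path (@sedge T) x p && (last x p == last x q)])
  (@nat_of_ord _).
- by apply/existsP; exists (in_tuple q); rewrite qP /= eqxx.
- exact: ltnW.
- by exists p; rewrite size_tuple; split=> //; rewrite -distE.
Qed.

Lemma dist_pred r v : connected T -> v != r ->
  exists2 u, sedge u v & dist r v = (dist r u).+1.
Proof.
move=> [_ conT] nvr; have [q [qP qv qdist qT]] := shortest_path (conT r v).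
case/lastP: q => [|q w] in qP qv qdist qT; first by rewrite -qv eqxx in nvr.
rewrite last_rcons in qv; move: qP; rewrite {w}qv rcons_path in qdist qT * => /andP[qP uv].
rewrite size_rcons in qdist qT; exists (last r q) => //.
have [q' [q'P q'u q'dist q'T]] := shortest_path (conT r (last r q)).
have le_u := dist_leq_path qP (ltnW qT).
have le_v : dist r v <= (dist r (last r q)).+1.
  have : path (@sedge T) r (rcons q' v) by rewrite rcons_path q'P q'u.
  move/dist_leq_path; rewrite last_rcons size_rcons q'dist; apply.
  by apply: leq_ltn_trans qT; rewrite ltnS.
by apply/eqP; rewrite eqn_leq le_v -qdist ltnS le_u.
Qed.

Lemma exists_center : 0 < #|T| -> exists r, forall v, dist r v <= radius T.
Proof.
case/card_gt0P=> r0 _.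
have [r _|r _ radiusE] := @eq_bigmin _ _ _ #|T| r0 predT (@eccentricity T) isT.
  by apply/bigmax_leqP=> v _; apply: dist_leq_card.
by exists r => v; rewrite /radius radiusE; apply: leq_bigmax.
Qed.

(* An edge outside [e] would close a cycle with an [e]-path between its ends. *)
Lemma acyclic_connect_edge (e : rel T) x y : acyclic T -> symmetric e -> subrel e (@sedge T) ->
  connect e x y -> sedge x y -> e x y.
Proof.
move=> acT e_sym e_sub /connectP[q0 q0P yE] xy.
case/shortenP: q0P yE => q qP q_uniq _ yE.
case: q => [|z [|z' q]] in qP q_uniq yE.
- by rewrite yE sedge_irrefl in xy.
- by move: qP; rewrite /= -[z]yE andbT.
suff /acT : ucycle (@sedge T) [:: x, z, z' & q] by [].
rewrite /ucycle q_uniq andbT /cycle rcons_path -yE sedge_sym xy andbT.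
exact: sub_path e_sub _ _ qP.
Qed.

Lemma exists_parent r : connected T -> exists parent : T -> T,
  [/\ forall v, parent v != v -> sedge v (parent v) /\ dist r v = (dist r (parent v)).+1
    & forall v, fconnect parent v r].
Proof.
move=> conT; have /choice[parent parentP] v : exists u,
    if v == r then u = r else sedge v u /\ dist r v = (dist r u).+1.
  case: eqVneq => [_|/(dist_pred conT)[u uv ru]]; first by exists r.
  by exists u; rewrite sedge_sym.
exists parent; split=> [v pv|v].
  have := parentP v; case: eqVneq => // vr pr.
  by rewrite pr vr eqxx in pv.
have [n] := ubnP (dist r v); elim: n => // n IH in v *; rewrite ltnS => dv.
have := parentP v; case: eqVneq => [-> _|_ [_ distE]]; first exact: connect0.
by apply: connect_trans (fconnect1 parent v) (IH _ _); rewrite -distE.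
Qed.

Lemma tree_edge_parent (parent : T -> T) r x y : acyclic T ->
  (forall v, parent v != v -> sedge v (parent v)) -> (forall v, fconnect parent v r) ->
  sedge x y -> parent x = y \/ parent y = x.
Proof.
move=> acT edge_parent to_root xy.
pose e : rel T := [rel u v | sedge u v && ((parent u == v) || (parent v == u))].
have e_sym : symmetric e by move=> u v; rewrite /e /= sedge_sym orbC.
have e_sub : subrel e (@sedge T) by move=> u v /andP[].
have e_root v : connect e v r.
  apply: connect_sub (to_root v) => u _ /eqP <-.
  have [->|pu] := eqVneq (parent u) u; first exact: connect0.
  by apply: connect1; rewrite /e /= edge_parent // eqxx.
have exy : connect e x y.
  by apply: connect_trans (e_root x) _; rewrite (sym_connect_sym e_sym).
by have /andP[_ /orP[]/eqP] := acyclic_connect_edge acT e_sym e_sub exy xy; [left|right].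
Qed.

End Distance.

Lemma model_minor (T G : sgraph) (parent : T -> T) (U B : {set G}) beta :
  (forall x y, sedge x y -> parent x = y \/ parent y = x) ->
  model parent [set: T] U B beta -> minor T G.
Proof.
move=> parent_edge [[conT _ injT] attT].
have adj x y : sedge x y -> parent x = y -> adjacent (beta x) (beta y).
  move=> xy px; have := attT x (in_setT x); rewrite /attached px !inE andbT.
  by rewrite adjacent_sym ifT //; apply: contraTneq xy => ->; rewrite sedge_irrefl.
exists beta; split=> [x|x y nxy|x y xy].
- by apply: conT; rewrite inE.
- rewrite -setI_eq0 -subset0; apply/subsetP=> u /setIP[ux uy].
  by rewrite (injT x y u) ?inE ?eqxx in nxy.
- apply/adjacentP; case: (parent_edge x y xy) => [/adj|/adj]; first exact.
  by rewrite sedge_sym adjacent_sym; apply.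
Qed.

Theorem theorem3 (T G : sgraph) (t h : nat)
    (T_tree : is_tree T) (T_card : #|T| = t) (t_ge3 : 3 <= t)
    (T_radius : radius T = h) (G_minor_free : ~ minor T G) :
  exists H : sgraph,
    pathwidth H <= 2 * h - 1 /\
    contained G (strong_product H (complete_graph (t - 2))).
Proof.
have [|r r_center] := @exists_center T; first by rewrite T_card; lia.
have [T_connected T_acyclic] := T_tree.
have [parent [parentP to_root]] := exists_parent r T_connected.
have depth_parent v : parent v != v -> dist r v = (dist r (parent v)).+1.
  by case/parentP.
have descE : descendants parent r = [set: T] by apply/setP=> v; rewrite !inE to_root.
rewrite subn1; apply: decomposable_contained; apply: contrapT => badG.
have closed := decomposable_hereditary_additive G (t - 2) (2 * h).
have [C [_ conC badC]] := exists_connected_not_good closed badG.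
have /set0Pn[a aC] := conC.1.
have unav : unavoidable parent (@decomposable G (t - 2) (2 * h)) r.
  apply: (unavoidable_of_height depth_parent) => [|w _|]; first by rewrite subn_gt0.
    by rewrite -T_radius (leq_trans (r_center w)) // leq_addl.
  by rewrite descE cardsT T_card; lia.
have [beta modelT] := unav C a conC aC badC.
rewrite descE in modelT; apply: G_minor_free; apply: model_minor modelT => x y.
by apply: (tree_edge_parent T_acyclic _ to_root) => v /parentP[].
Qed.
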